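(* Every graph $G$ with maximum degree $\Delta(G) \geq 1$ satisfies $$\chi_{pc}(G) \leq \Delta(G) + \left\lceil \frac{|V(G)|}{2} \right\rceil .$$
   Context: All graphs are finite and simple, with at least one vertex. Let $k$ be a positive integer. A $k$-assignment $L$ for a graph $G$ assigns to each vertex $v$ a set $L(v)$ of exactly $k$ colors; its palette is $\mathcal{L} = \bigcup_{v \in V(G)} L(v)$, and for $c \in \mathcal{L}$, $\eta(c) = |\{v \in V(G) : c \in L(v)\}|$. A proper $L$-coloring of $G$ is a proper coloring $f$ of $G$ with $f(v) \in L(v)$ for every vertex $v$. It is a proportional $L$-coloring if for every $c \in \mathcal{L}$, $|f^{-1}(c)|$ equals $\lfloor \eta(c)/k \rfloor$ or $\lceil \eta(c)/k \rceil$. $G$ is proportionally $k$-choosable if a proportional $L$-coloring of $G$ exists for every $k$-assignment $L$ for $G$. The proportional choice number $\chi_{pc}(G)$ is the smallest positive integer $k$ such that $G$ is proportionally $k$-choosable. *)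

(* Defs.v *)
From mathcomp Require Import all_boot.
From mathcomp Require Import boolp.
Set Implicit Arguments.
Unset Strict Implicit.
Unset Printing Implicit Defensive.

Record sgraph := SGraph {
  vertex :> finType;
  adj : rel vertex;
  adj_sym : symmetric adj;
  adj_irrefl : irreflexive adj;
  vertex_gt0 : 0 < #|vertex| }.

Definition degree (G : sgraph) (v : G) : nat := #|[set w | adj v w]|.

Definition max_degree (G : sgraph) : nat := \max_(v : G) degree v.

(* The ceiling of n / d, for d > 0. *)
Definition ceil_div (n d : nat) : nat := (n + d.-1) %/ d.

(* Colors live in an arbitrary finite type C, which may be strictly larger than
   the palette. *)
Definition list_assignment (G : sgraph) (C : finType) : Type := G -> {set C}.

Definition is_assignment (G : sgraph) (C : finType) (k : nat)
  (L : list_assignment G C) : Prop := forall v : G, #|L v| = k.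

Definition palette (G : sgraph) (C : finType) (L : list_assignment G C) :
  {set C} := \bigcup_(v : G) L v.

Definition eta (G : sgraph) (C : finType) (L : list_assignment G C) (c : C) :
  nat := #|[set v : G | c \in L v]|.

Definition proper_coloring (G : sgraph) (C : finType) (f : G -> C) : Prop :=
  forall v w : G, adj v w -> f v <> f w.

Definition proper_list_coloring (G : sgraph) (C : finType)
  (L : list_assignment G C) (f : G -> C) : Prop :=
  proper_coloring f /\ forall v : G, f v \in L v.

Definition proportional_coloring (G : sgraph) (C : finType) (k : nat)
  (L : list_assignment G C) (f : G -> C) : Prop :=
  proper_list_coloring L f /\
  forall c : C, c \in palette L ->
    #|[set v | f v == c]| = eta L c %/ k \/
    #|[set v | f v == c]| = ceil_div (eta L c) k.

Definition proportionally_choosable (G : sgraph) (k : nat) : Prop :=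
  forall (C : finType) (L : list_assignment G C), is_assignment k L ->
    exists f : G -> C, proportional_coloring k L f.

Lemma injective_list_coloring (G : sgraph) (C : finType)
    (L : list_assignment G C) :
  is_assignment #|G|.+1 L ->
  exists2 f : G -> C, injective f & forall v, f v \in L v.
Proof.
move=> kL.
suff H (s : seq G) : uniq s ->
    exists2 f : G -> C, {in s &, injective f} & forall v, f v \in L v.
  have [f injf fL] := H _ (enum_uniq G).
  by exists f => // x y; apply: injf; rewrite mem_enum.
elim: s => [|v s IHs] /=.
  have /fin_all_exists[f fL] (v : G) : exists c, c \in L v.
    by apply/card_gt0P; rewrite kL.
  by exists f.
case/andP=> vs us; have [f injf fL] := IHs us.
have [c cL cf] : exists2 c, c \in L v & c \notin map f s.
  have /card_gt0P[c] : 0 < #|L v :\: [set c in map f s]|.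
    rewrite cardsD kL subn_gt0 ltnS.
    apply: leq_trans (subset_leq_card (subsetIr _ _)) _.
    rewrite cardsE; apply: leq_trans (card_size _) _.
    by rewrite size_map -(card_uniqP us) max_card.
  by rewrite !inE => /andP[? ?]; exists c.
exists (fun w => if w == v then c else f w) => [x y|w]; last first.
  by case: eqP => [->|].
rewrite !inE.
case: (eqVneq x v) => [->|_] /=; case: (eqVneq y v) => [->|_] //= xs ys.
- by move=> E; rewrite E (map_f f ys) in cf.
- by move=> E; rewrite -E (map_f f xs) in cf.
- exact: injf.
Qed.

Lemma ex_proportionally_choosable (G : sgraph) :
  exists k, (0 < k) && `[< proportionally_choosable G k >].
Proof.
exists #|G|.+1; rewrite ltnS leq0n /=; apply/asboolP => C L kL.
have [f injf fL] := injective_list_coloring kL.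
exists f; split=> [|c]; first split=> // v w vw /injf E.
  by rewrite E adj_irrefl in vw.
case/bigcupP=> v _ cv; rewrite /ceil_div /=.
have eta_le : eta L c <= #|G| by apply: max_card.
have eta_gt0 : 0 < eta L c by apply/card_gt0P; exists v; rewrite inE.
have -> : (eta L c + #|G|) %/ #|G|.+1 = 1.
  rewrite -(prednK eta_gt0) addSnnS divnDr // divnn /= divn_small //.
  by rewrite (leq_trans _ (leqW eta_le)) // prednK.
rewrite divn_small ?ltnS //.
have : #|[set w | f w == c]| <= 1.
  apply/card_le1_eqP => x y; rewrite !inE => /eqP fx /eqP fy.
  by apply: injf; rewrite fx fy.
by case: #|_| => [|[]] //; [left|right].
Qed.

Definition chi_pc (G : sgraph) : nat := ex_minn (ex_proportionally_choosable G).

(* Main.v *)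
Require Import Defs.
From mathcomp Require Import all_boot.
From mathcomp Require Import boolp zify.

(** With [k = Delta + ceil (n/2)], ignore adjacency first. Among all choices of
    a color from each list, take one minimizing the sum over the colors [c] of
    [(k |f^-1(c)| - eta c)^2]. If some [c] had [| k |f^-1(c)| - eta c | >= k],
    double counting over the colors reachable from [c] (or co-reachable) by
    recoloring one vertex at a time would give a color with a discrepancy of
    the opposite sign, and shifting one unit along a recoloring path would
    decrease the sum. Hence all classes have size floor or ceiling of
    [eta c / k], which is at most 2.

    Among these choices, take one with the fewest vertices in a monochromatic
    edge. If [uv] is such an edge, of color [c], then [f^-1(c) = {u, v}] and
    [eta c > k]. At least [k - Delta] colors of [L u] are absent from the
    neighborhood of [u]. If one of them is unused, give it to [u]. Otherwise
    they are carried by at least [n/2] vertices; at least [n/2] non-neighbors of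
    [v] have [c] in their list; both sets avoid [v], so they share a vertex [x],
    and exchanging the colors of [u] and [x] removes the conflict. *)

Set Implicit Arguments.
Unset Strict Implicit.
Unset Printing Implicit Defensive.

Section Colorings.

Variables (G : sgraph) (C : finType).
Implicit Types (f : {ffun G -> C}) (L : list_assignment G C) (T : {set C}).

(** * Recoloring single vertices and shifting along paths *)

Definition class_size f (c : C) : nat := #|[set v | f v == c]|.

Definition recolor f (u : G) (d : C) : {ffun G -> C} :=
  [ffun w => if w == u then d else f w].

Definition recolor_arc L f : rel C :=
  fun c d => [exists v, (f v == c) && (d \in L v)].

Definition list_valid L f : bool := [forall v, f v \in L v].

(** Division-free way to say that each class size differs from [eta L c / k] by less than 1, hence
    is its floor or ceiling. *)
Definition balanced (k : nat) L f : bool :=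
  [forall c, (k * class_size f c < eta L c + k) &&
             (eta L c < k * class_size f c + k)].

Lemma class_size_recolor f u d e :
  class_size (recolor f u d) e + (e == f u) = class_size f e + (e == d).
Proof.
rewrite /class_size (cardsD1 u) [in RHS](cardsD1 u) !inE ffunE eqxx.
have -> : [set w | recolor f u d w == e] :\ u = [set w | f w == e] :\ u.
  by apply/setP => w; rewrite !inE ffunE; case: eqP.
by rewrite (eq_sym d) (eq_sym (f u)); lia.
Qed.

Lemma list_valid_recolor L f u d :
  list_valid L f -> d \in L u -> list_valid L (recolor f u d).
Proof.
by move=> /forallP fL dL; apply/forallP => w; rewrite ffunE; case: eqP => [->|].
Qed.

(** Recolor one vertex per arc: each inner color loses a vertex and gains one, so only the two ends
    of the path change. *)
Lemma shift_along_path L p f c :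
  list_valid L f -> path (recolor_arc L f) c p -> uniq (c :: p) ->
  exists2 f', list_valid L f' &
    forall e, class_size f' e + (e == c) = class_size f e + (e == last c p).
Proof.
elim: p f c => [|d p IHp] f c fL; first by exists f.
rewrite [path _ _ _]/= => /andP[/existsP[v /andP[/eqP fv dL]] pp].
rewrite cons_uniq => /andP[cp up].
pose f1 := recolor f v d.
(* Recoloring [v] can only destroy arcs leaving [c], and by uniqueness the rest of the path avoids
   [c]. *)
have pp1 : path (recolor_arc L f1) d p.
  apply: (@sub_in_path _ (predC1 c) (recolor_arc L f)) pp.
    move=> a b /= ac _ /existsP[w /andP[/eqP fw bL]].
    apply/existsP; exists w; rewrite ffunE bL andbT.
    by case: (w =P v) => [E|_]; [rewrite -fw E fv inE eqxx in ac | rewrite fw].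
  by apply/allP => a adp /=; apply: contraNneq cp => <-.
have [f' f'L cf'] := IHp _ _ (list_valid_recolor fL dL) pp1 up.
exists f' => // e /=.
have := class_size_recolor f v d e; have := cf' e; rewrite fv /f1; lia.
Qed.

(** * Double counting and existence of balanced list colorings *)

Lemma sum_eta L T : \sum_(d in T) eta L d = \sum_v #|L v :&: T|.
Proof.
transitivity (\sum_(d in T) \sum_v (d \in L v : nat)).
  by apply: eq_bigr => d _; rewrite /eta -sum1dep_card big_mkcond.
rewrite exchange_big; apply: eq_bigr => v _ /=.
rewrite -big_mkcondr sum1dep_card; apply: eq_card => d.
by rewrite !inE andbC.
Qed.

Lemma sum_class_size f T :
  \sum_(d in T) class_size f d = \sum_v (f v \in T : nat).
Proof.
transitivity (\sum_(d in T) \sum_v (f v == d : nat)).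
  by apply: eq_bigr => d _; rewrite /class_size -sum1dep_card big_mkcond.
rewrite exchange_big; apply: eq_bigr => v _ /=.
rewrite -big_mkcondr sum1dep_card.
case: (boolP (f v \in T)) => fT.
  rewrite [in RHS](_ : true = 1 :> nat) // -(cards1 (f v)); apply: eq_card => d.
  by rewrite !inE eq_sym; case: eqP => [->|]; rewrite ?fT ?andbF.
apply: eq_card0 => d; rewrite !inE.
by apply: contraNF fT => /andP[dT /eqP ->].
Qed.

(* Up to a positive factor and a constant this is the sum of
   [(k * class_size f c - eta L c) ^ 2]: the sum of the class sizes is constant,
   and shifting by [#|G|] keeps everything in [nat]. *)
Definition imbalance (k : nat) L f : nat :=
  \sum_c class_size f c * (k * class_size f c + 2 * (#|G| - eta L c)).

Lemma eta_le_card L c : eta L c <= #|G|.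
Proof. exact: max_card. Qed.

(** Moving one unit from [c] to [d] changes [imbalance] by twice the left side minus the right side
    of the inequality; the terms in [#|G|] cancel. *)
Lemma imbalance_shift k L f f' c d :
  (forall e, class_size f' e + (e == c) = class_size f e + (e == d)) ->
  k * class_size f d + eta L c + k < k * class_size f c + eta L d ->
  imbalance k L f' < imbalance k L f.
Proof.
move=> ff' lt_dc.
have dc : d != c by apply/eqP => E; move: lt_dc; rewrite E; lia.
rewrite /imbalance (bigD1 c) // (bigD1 d) //= [ltnRHS](bigD1 c) //.
rewrite [in ltnRHS](bigD1 d) //= !addnA.
set A := \sum_(i | _) _; set B := \sum_(i | _) _.
have -> : A = B.
  apply: eq_bigr => e /andP[ec ed].
  have := ff' e; rewrite (negPf ec) (negPf ed) !addn0 => -> //.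
rewrite ltn_add2r.
have := ff' c; have := ff' d; have := eta_le_card L c; have := eta_le_card L d.
rewrite !eqxx (negPf dc) eq_sym (negPf dc).
move: lt_dc; set x := class_size f c; set y := class_size f d.
move: (eta L c) (eta L d) (class_size f' c) (class_size f' d) (#|G|).
move=> a b x' y' n lt_dc bn an Ey Ex; have -> : y' = y.+1 by lia.
move: lt_dc; have -> : x = x'.+1 by lia.
rewrite -(subnKC an) -(subnKC bn); nia.
Qed.

Lemma sum_ltP (T : finType) (A : {set T}) (F H : T -> nat) c :
  c \in A -> F c < H c -> \sum_(d in A) H d <= \sum_(d in A) F d ->
  exists2 d, d \in A & H d < F d.
Proof.
move=> cA FHc le_HF.
case: (boolP [exists d in A, H d < F d]) => [/exists_inP //|/exists_inPn noHF].
move: le_HF; rewrite (bigD1 c) // (bigD1 (F := F) c) //=.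
suff : \sum_(i in A | i != c) F i <= \sum_(i in A | i != c) H i by lia.
by apply: leq_sum => i /andP[iA _]; rewrite leqNgt noHF.
Qed.

Lemma balanced_of_min k L f :
  0 < k -> is_assignment k L -> list_valid L f ->
  (forall f', list_valid L f' -> imbalance k L f <= imbalance k L f') ->
  balanced k L f.
Proof.
move=> k0 kL fL fmin.
have noshift c d : connect (recolor_arc L f) c d ->
    k * class_size f c + eta L d <= k * class_size f d + eta L c + k.
  case/connectP => p /shortenP[p' pp' up' _ ->{d}].
  have [f' f'L ff'] := shift_along_path fL pp' up'.
  rewrite leqNgt; apply/negP => lt_dc.
  by have := fmin _ f'L; rewrite leqNgt (imbalance_shift ff' lt_dc).
apply/forallP => c; apply/andP; split; rewrite ltnNge; apply/negP => bad_c.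
  (* [T] is closed under arcs: a vertex colored in [T] has its whole list in [T], so it adds [k] to
     the sum of [eta] over [T]. *)
  pose T := [set d | connect (recolor_arc L f) c d].
  have [|||d] := @sum_ltP _ T (eta L) (fun d => k * class_size f d) c.
  - by rewrite inE connect0.
  - by lia.
  - rewrite -big_distrr sum_class_size sum_eta /= big_distrr /=.
    apply: leq_sum => v _; case: (boolP (f v \in T)) => fT; last by rewrite muln0.
    rewrite muln1 -(kL v); apply/subset_leq_card/subsetIP; split=> //.
    apply/subsetP => d dL; rewrite inE in fT; rewrite inE.
    apply: connect_trans fT (connect1 _).
    by apply/existsP; exists v; rewrite eqxx.
  - by rewrite inE => /noshift; lia.
(* Dually, a vertex colored outside this [T] has a list disjoint from [T]. *)
pose T := [set d | connect (recolor_arc L f) d c].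
have [|||d] := @sum_ltP _ T (fun d => k * class_size f d) (eta L) c.
- by rewrite inE connect0.
- by lia.
- rewrite -big_distrr sum_class_size sum_eta /= big_distrr /=.
  apply: leq_sum => v _; case: (boolP (f v \in T)) => fT.
    by rewrite muln1 -(kL v); apply/subset_leq_card/subsetIl.
  rewrite muln0 leqn0 cards_eq0; apply/eqP/setP => d; rewrite !inE.
  apply: contraNF fT => /andP[dL dc]; rewrite inE.
  apply: connect_trans (connect1 _) dc.
  by apply/existsP; exists v; rewrite eqxx.
- by rewrite inE => /noshift; lia.
Qed.

Lemma ex_balanced k L :
  0 < k -> is_assignment k L -> exists2 f, list_valid L f & balanced k L f.
Proof.
move=> k0 kL.
have /fin_all_exists[g gL] (v : G) : exists c, c \in L v.
  by apply/card_gt0P; rewrite kL.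
have g0 : list_valid L (finfun g) by apply/forallP => v; rewrite ffunE.
case: (arg_minnP (imbalance k L) g0) => f fL fmin.
by exists f => //; apply: balanced_of_min => // f' /fmin.
Qed.

Lemma balanced_class_size k L f c :
  0 < k -> balanced k L f ->
  class_size f c = eta L c %/ k \/ class_size f c = ceil_div (eta L c) k.
Proof.
move=> k0 /forallP/(_ c)/andP[]; rewrite /ceil_div.
move: (class_size f c) (eta L c) => x n lt1 lt2.
have := divn_eq n k; have := ltn_pmod n k0.
have := divn_eq (n + k.-1) k; have := ltn_pmod (n + k.-1) k0.
move: (n %/ k) (n %% k) ((n + k.-1) %/ k) ((n + k.-1) %% k) => q r q' r'.
move=> r'k E' rk E.
have q1 : q < x.+1 by nia.
have x1 : x < q.+2 by nia.
have [->|xq] := eqVneq x q; first by left.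
have {xq x1 q1} Ex : x = q.+1 by lia.
(* A class of size [q.+1] forces a nonzero remainder [r], so the ceiling exceeds [q]. *)
have q'1 : q < q' by nia.
have q'2 : q' < q.+2 by nia.
by right; lia.
Qed.

(** * Removing monochromatic edges *)

Definition conflicts f : {set G} := [set v | [exists w, adj v w && (f v == f w)]].

Lemma conflictsP f v :
  reflect (exists2 w, adj v w & f v = f w) (v \in conflicts f).
Proof.
rewrite inE; apply: (iffP existsP) => [[w /andP[vw /eqP]]|[w vw /eqP fvw]].
  by exists w.
by exists w; rewrite vw.
Qed.

Lemma degree_le_max (v : G) : degree v <= max_degree G.
Proof. exact: (leq_bigmax v). Qed.

Lemma card_absent_colors k L f u :
  is_assignment k L ->
  k - max_degree G <= #|L u :\: f @: [set w | adj u w]|.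
Proof.
move=> kL; rewrite cardsD kL; apply: leq_sub2l.
apply: leq_trans (subset_leq_card (subsetIr _ _)) _.
exact: leq_trans (leq_imset_card _ _) (degree_le_max u).
Qed.

Lemma card_nonadjacent_holders L c v :
  c \in L v ->
  eta L c <= #|[set x | (c \in L x) && ~~ adj v x] :\ v| + (max_degree G).+1.
Proof.
move=> cv; pose X := [set x | (c \in L x) && ~~ adj v x].
(* The extra unit in the bound pays for [v], which is not its own neighbor. *)
have vX : v \in X by rewrite inE cv adj_irrefl.
have := cardsD1 v X; rewrite vX -/X.
suff : eta L c <= #|X| + max_degree G by lia.
rewrite /eta -(cardsID [set w | adj v w]) addnC leq_add //.
  by apply/subset_leq_card/subsetP => x; rewrite !inE andbC.
exact: leq_trans (subset_leq_card (subsetIr _ _)) (degree_le_max v).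
Qed.

Lemma conflict_reduction k L f u :
  is_assignment k L -> #|G| < 2 * k -> #|G| <= 2 * (k - max_degree G) ->
  max_degree G <= k ->
  list_valid L f -> balanced k L f -> u \in conflicts f ->
  exists f', [/\ list_valid L f', balanced k L f' &
                 #|conflicts f'| < #|conflicts f|].
Proof.
move=> kL n2k nkD Dk fL fbal cfu; have [v uv fuv] := conflictsP _ _ cfu.
have /andP[c1 c2] := forallP fbal (f u).
have etan := eta_le_card L (f u).
have uNv : u != v by apply: contraTneq uv => ->; rewrite adj_irrefl.
have uv_class : [set u; v] \subset [set w | f w == f u].
  by apply/subsetP => w; rewrite !inE => /orP[] /eqP ->; rewrite // fuv.
have size2 : class_size f (f u) = 2.
  have := subset_leq_card uv_class; rewrite cards2 uNv -/(class_size f (f u)).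
  by move=> le2; nia.
have only_uv w : f w = f u -> (w == u) || (w == v).
  have /eqP/setP/(_ w) : [set u; v] == [set w | f w == f u].
    by rewrite eqEcard uv_class cards2 uNv -/(class_size f (f u)) size2.
  by rewrite !inE => -> /eqP.
have decr f' : u \notin conflicts f' -> conflicts f' \subset conflicts f ->
    #|conflicts f'| < #|conflicts f|.
  move=> uf' sub; apply: proper_card; rewrite properE sub /=.
  by apply: contra uf' => /subsetP; apply.
pose D := L u :\: f @: [set w | adj u w].
have fD w d : d \in D -> adj u w -> f w != d.
  rewrite inE => /andP[dN _] uw; apply: contraNneq dN => <-.
  by apply: imset_f; rewrite inE.
have DL d : d \in D -> d \in L u by rewrite inE => /andP[].
have D_ge : k - max_degree G <= #|D| by apply: card_absent_colors.
case: (boolP [exists d in D, class_size f d == 0]).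
  case/exists_inP=> d dD /eqP d0.
  have fNd w : f w != d.
    by move/eqP: d0; rewrite cards_eq0 => /eqP/setP/(_ w); rewrite !inE => ->.
  have cs := class_size_recolor f u d.
  exists (recolor f u d); split; first exact: list_valid_recolor (DL _ dD).
    (* Both [d] and [f u] end with one vertex each, which is balanced because their [eta] lies
       strictly between 0 and [2 * k]. *)
    apply/forallP => e; have /andP[b1 b2] := forallP fbal e; have := cs e.
    case: (eqVneq e d) => [Ed|Ned].
      rewrite Ed (_ : d == f u = false); last by rewrite eq_sym (negPf (fNd u)).
      rewrite d0 addn0 => ->; move: b1 b2; rewrite Ed d0 => b1 b2.
      have : 0 < eta L d by apply/card_gt0P; exists u; rewrite inE DL.
      by lia.
    case: (eqVneq e (f u)) => [Ee|Nee]; last by rewrite !addn0 => ->; rewrite b1 b2.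
    by rewrite Ee size2 => cs1; have -> : class_size (recolor f u d) (f u) = 1; lia.
  have uf' : u \notin conflicts (recolor f u d).
    apply/negP => /conflictsP[w uw]; rewrite !ffunE eqxx.
    case: eqP => [E|_ E]; first by rewrite E adj_irrefl in uw.
    by have := fNd w; rewrite -E eqxx.
  apply: decr uf' _; apply/subsetP => w wf'; case: (eqVneq w u) => [->//|Nwu].
  have [w' ww'] := conflictsP _ _ wf'; rewrite !ffunE (negPf Nwu).
  case: eqP => [_ E|_ E]; first by have := fNd w; rewrite E eqxx.
  by apply/conflictsP; exists w'.
move/exists_inPn => used.
pose X := [set x | (f u \in L x) && ~~ adj v x] :\ v.
have X_ge : k - max_degree G <= #|X|.
  have cv : f u \in L v by rewrite fuv; apply: (forallP fL).
  (* A balanced class of size 2 gives [k < eta L (f u)], which absorbs the extra unit. *)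
  by have := card_nonadjacent_holders cv; rewrite -/X; nia.
pose Y := [set x | f x \in D].
have Y_ge : k - max_degree G <= #|Y|.
  apply: leq_trans D_ge _; apply: leq_trans (leq_imset_card f Y).
  apply/subset_leq_card/subsetP => d dD; have := used d dD.
  rewrite -lt0n => /card_gt0P[x]; rewrite inE => /eqP fx.
  by rewrite -fx; apply: imset_f; rewrite inE fx.
have [x xX xY] : exists2 x, x \in X & x \in Y.
  case: (set_0Vmem (X :&: Y)) => [dXY|[x /setIP[]]]; last by exists x.
  have : #|X :|: Y| <= #|[set~ v]|.
    apply/subset_leq_card/subsetP => x; rewrite !inE.
    case/orP=> [/andP[]//|/andP[xN _]]; apply: contraNneq xN => ->.
    by apply: imset_f; rewrite inE.
  (* Disjointness would fit at least [#|G|] vertices into the [#|G| - 1] vertices other than [v]. *)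
  have := cardsUI X Y; rewrite dXY cards0 cardsC1.
  have : 0 < #|G| by apply/card_gt0P; exists u.
  by move: X_ge Y_ge nkD; lia.
rewrite inE in xY; move: xX; rewrite !inE => /and3P[xNv cx vx].
have fxu : f x != f u by have := fD v _ xY uv; rewrite -fuv eq_sym.
have xNu : x != u by apply: contraNneq fxu => ->.
pose f' := recolor (recolor f u (f x)) x (f u).
have f'E w : f' w = if w == x then f u else if w == u then f x else f w.
  by rewrite !ffunE.
have f'u : f' u = f x by rewrite f'E eq_sym (negPf xNu) eqxx.
have f'x : f' x = f u by rewrite f'E eqxx.
have cs e : class_size f' e = class_size f e.
  have := class_size_recolor f u (f x) e.
  have := class_size_recolor (recolor f u (f x)) x (f u) e.
  by rewrite ffunE (negPf xNu) -/f'; lia.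
have good_u w : adj u w -> f' w != f x.
  move=> uw; rewrite f'E; case: (w =P x) => [_|_]; first by rewrite eq_sym.
  by case: (w =P u) => [E|_]; [rewrite E adj_irrefl in uw | apply: fD].
(* Once [u] has given up [f u], its only other holder is [v], which is not adjacent to [x]. *)
have good_x w : adj x w -> f' w != f u.
  move=> xw; rewrite f'E; case: (w =P x) => [E|_]; first by rewrite E adj_irrefl in xw.
  case: (w =P u) => [//|/eqP Nwu]; apply/eqP => /only_uv; rewrite (negPf Nwu) /=.
  by move/eqP=> E; rewrite -E adj_sym xw in vx.
exists f'; split.
- by apply: list_valid_recolor cx; apply: list_valid_recolor (DL _ xY).
- by apply/forallP => e; rewrite cs; apply: (forallP fbal).
(* Monochromatic edges of [f'] avoid [u] and [x], so they were already monochromatic under [f]. *)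
have adj_same_u w w' : adj w w' -> f' w = f' w' -> w != u.
  move=> ww' E; apply: contraTneq ww' => wu; apply/negP => /[!wu]/good_u.
  by rewrite -E wu f'u eqxx.
have adj_same_x w w' : adj w w' -> f' w = f' w' -> w != x.
  move=> ww' E; apply: contraTneq ww' => wx; apply/negP => /[!wx]/good_x.
  by rewrite -E wx f'x eqxx.
apply: decr.
  by apply/conflictsP => -[w uw /(adj_same_u _ _ uw)]; rewrite eqxx.
apply/subsetP => w /conflictsP[w' ww' f'w].
have w'w : adj w' w by rewrite adj_sym.
have [Nwu Nw'u] := (adj_same_u _ _ ww' f'w, adj_same_u _ _ w'w (esym f'w)).
have [Nwx Nw'x] := (adj_same_x _ _ ww' f'w, adj_same_x _ _ w'w (esym f'w)).
apply/conflictsP; exists w' => //; move: f'w; rewrite !f'E.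
by rewrite (negPf Nwu) (negPf Nwx) (negPf Nw'u) (negPf Nw'x).
Qed.

End Colorings.

Lemma proportionally_choosable_ge (G : sgraph) (k : nat) :
  #|G| < 2 * k -> max_degree G <= k -> #|G| <= 2 * (k - max_degree G) ->
  proportionally_choosable G k.
Proof.
move=> n2k Dk nkD C L kL.
have k0 : 0 < k by lia.
have [g gL gbal] := ex_balanced k0 kL.
pose P := [pred f : {ffun G -> C} | list_valid L f && balanced k L f].
have Pg : P g by rewrite /= gL.
case: (arg_minnP (fun f : {ffun G -> C} => #|conflicts f|) Pg).
move=> f /andP[fL fbal] fmin; exists f.
split=> [|c _]; last exact: balanced_class_size fbal.
split=> [v w vw fvw|v]; last exact: (forallP fL).
have cf : v \in conflicts f by apply/conflictsP; exists w.
have [f' [f'L f'bal]] := conflict_reduction kL n2k nkD Dk fL fbal cf.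
by rewrite ltnNge fmin //= f'L.
Qed.

Theorem theorem6 (G : sgraph) (hG : 1 <= max_degree G) :
  chi_pc G <= max_degree G + ceil_div #|G| 2.
Proof.
rewrite /chi_pc; case: ex_minnP => m _; apply.
have n2 : #|G| <= 2 * ceil_div #|G| 2 by rewrite /ceil_div; lia.
apply/andP; split; first by lia.
(* [hG] makes the inequality [#|G| < 2 * k] strict. *)
by apply/asboolP; apply: proportionally_choosable_ge; lia.
Qed.
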